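(* Let $m\ge2$, $N\ge1$, and let $T_i(\kappa)$, $1\le i\le N$, be the Dunkl operators of $G(m,1,N)$ with parameters $\kappa=(\kappa_0,\kappa_1,\dots,\kappa_{m-1})$. Let $1\le t\le m-1$ and let $g$ be any polynomial in $y=(x_1^m,\dots,x_N^m)$. Then $$T_i(\kappa)^m\,x^{tv}g(y)=x^{tv}\,T_i(\kappa')^m\,g(y)\qquad(1\le i\le N),$$ where $v=(1,1,\dots,1)\in\mathbb{N}^N$ and $\kappa'=(\kappa_0,\kappa_1+1,\dots,\kappa_t+1,\kappa_{t+1},\dots,\kappa_{m-1})$.
   Context: $\eta=e^{2\pi\mathrm{i}/m}$, $x=(x_1,\dots,x_N)$, $x^\alpha=\prod x_i^{\alpha_i}$ (so $x^{tv}=(x_1\cdots x_N)^t$). $w\in S_N$ acts on polynomials by $w(x^\alpha)=x^{w\alpha}$, $(w\alpha)_i=\alpha_{w^{-1}(i)}$; $(i,j)$ is the transposition; $\tau_i$ acts by $\tau_ix^\alpha=\eta^{\alpha_i}x^\alpha$. For parameters $\kappa=(\kappa_0,\dots,\kappa_{m-1})$, $$T_i(\kappa)=\frac{\partial}{\partial x_i}+\kappa_0\sum_{j\ne i}\sum_{s=0}^{m-1}\frac{1-\tau_i^{-s}(i,j)\tau_i^s}{x_i-\eta^sx_j}+\sum_{t=1}^{m-1}\kappa_t\sum_{s=0}^{m-1}\frac{\eta^{-st}\tau_i^s}{x_i}$$ on polynomials in $x$ (divisions after applying numerators). *)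

(* Defs.v *)
From HB Require Import structures.
From mathcomp Require Import all_boot all_order all_algebra all_fingroup.
From mathcomp Require Import fraction complex boolp reals.
From mathcomp Require Import mpoly.
From mathcomp Require trigo.

Set Implicit Arguments.
Unset Strict Implicit.
Unset Printing Implicit Defensive.

Import GRing.Theory.
Local Open Scope ring_scope.

Definition eta_m (R : realType) (m : nat) : R[i] :=
  Complex (trigo.cos (2 * trigo.pi / m%:R)) (trigo.sin (2 * trigo.pi / m%:R)).

Section Dunkl.
Variables (F : fieldType) (N : nat).
Implicit Types (e : F) (f : {mpoly F[N]}) (i j : 'I_N).

Definition tau e i f : {mpoly F[N]} :=
  \sum_(a <- msupp f) (f@_a * e ^+ a i) *: 'X_[a].

(* The inverse of [tau e i] is [tau e^-1 i] (see [tauVK]), so this is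
   tau_i^(-s) (i,j) tau_i^s. *)
Definition refl e i j (s : nat) f : {mpoly F[N]} :=
  iter s (tau e^-1 i) (msym (tperm i j) (iter s (tau e i) f)).

(* The last summands are polynomials only after summation over s, so T_i f is
   first written as an element of F(x_1, ..., x_N). *)
Definition dunkl_frac e m (kappa : m.-tuple F) i f : {fraction {mpoly F[N]}} :=
  tofrac f^`M(i)
  + tofrac (kappa`_0)%:MP *
      \sum_(j < N | j != i) \sum_(s < m)
        tofrac (f - refl e i j s f) / tofrac ('X_i - e ^+ s *: 'X_j)
  + \sum_(1 <= t < m) tofrac (kappa`_t)%:MP *
      \sum_(s < m) tofrac (e ^- (s * t) *: iter s (tau e i) f) / tofrac 'X_i.

Definition kappa_shift m (t : nat) (kappa : m.-tuple F) : m.-tuple F :=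
  [tuple if (1 <= j <= t)%N then kappa`_j + 1 else kappa`_j | j < m].

(* The default value 0 is never used when e is a primitive m-th root of unity:
   see [dunklE]. *)
Definition dunkl e m (kappa : m.-tuple F) i f : {mpoly F[N]} :=
  match pselect (exists q, tofrac q == dunkl_frac e kappa i f) with
  | left ex_q => xchoose ex_q
  | right _ => 0
  end.

Lemma mcoeff_tau e i f a : (tau e i f)@_a = f@_a * e ^+ a i.
Proof.
rewrite /tau raddf_sum /=.
under eq_bigr do rewrite mcoeffZ mcoeffX.
have [af|af] := boolP (a \in msupp f).
  rewrite (bigD1_seq a) ?msupp_uniq //= eqxx mulr1 big1 ?addr0 // => b ba.
  by rewrite (negbTE ba) mulr0.
rewrite (memN_msupp_eq0 af) mul0r big_seq big1 // => b bf.
by case: eqP => [ba|_]; [rewrite -ba bf in af | rewrite mulr0].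
Qed.

Lemma mcoeff_iter_tau e i s f a :
  (iter s (tau e i) f)@_a = f@_a * e ^+ (s * a i).
Proof.
elim: s => [|s IHs]; first by rewrite mul0n mulr1.
by rewrite /= mcoeff_tau IHs -mulrA -exprD mulSnr.
Qed.

Lemma tauVK e i : e != 0 -> cancel (tau e i) (tau e^-1 i).
Proof.
move=> e0 f; apply/mpolyP => a.
by rewrite !mcoeff_tau exprVn mulfK // expf_neq0.
Qed.

Lemma tauX e i (a : 'X_{1..N}) : tau e i 'X_[a] = e ^+ a i *: 'X_[a].
Proof.
apply/mpolyP => b; rewrite mcoeff_tau mcoeffZ mcoeffX.
by case: eqP => [->|_]; rewrite ?mul1r ?mulr1 // mul0r mulr0.
Qed.


Lemma mcoeff_refl e i j s f a :
  (refl e i j s f)@_a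
  = f@_[multinom a (tperm i j k) | k < N] * e ^+ (s * a j) * e^-1 ^+ (s * a i).
Proof.
rewrite /refl mcoeff_iter_tau mcoeff_sym mcoeff_iter_tau.
by rewrite mnmE tpermL.
Qed.

Lemma refl_dvd e i j s f : e != 0 -> j != i ->
  exists q, f - refl e i j s f = q * ('X_i - e ^+ s *: 'X_j).
Proof.
move=> e0 ji; set d := 'X_i - _.
pose c (a : 'X_{1..N}) := e ^+ (s * a i) * e^-1 ^+ (s * a j).
pose p (a : 'X_{1..N}) := [multinom a (tperm i j k) | k < N].
have pK : involutive p by move=> a; apply/mnmP => k; rewrite !mnmE tpermK.
have reflX a : refl e i j s 'X_[a] = c a *: 'X_[p a].
  apply/mpolyP => b; rewrite mcoeff_refl mcoeffZ !mcoeffX -/(p b) (inv_eq pK).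
  case: eqP => [->|_]; last by rewrite mulr0 !mul0r.
  by rewrite mul1r mulr1 /c !mnmE tpermL tpermR.
have XP a : exists q, 'X_[a] - refl e i j s 'X_[a] = q * d.
  have D0 : exists q, 'X_[0%MM] - refl e i j s 'X_[0%MM] = q * d.
    exists 0; rewrite reflX /c !mnm0E !muln0 !expr0 mulr1 scale1r.
    suff -> : p 0%MM = 0%MM by rewrite subrr mul0r.
    by apply/mnmP => k; rewrite mnmE !mnm0E.
  have DD b b' : (exists q, 'X_[b] - refl e i j s 'X_[b] = q * d) ->
      (exists q, 'X_[b'] - refl e i j s 'X_[b'] = q * d) ->
      exists q, 'X_[(b + b')%MM] - refl e i j s 'X_[(b + b')%MM] = q * d.
    move=> [q Hq] [q' Hq'].
    exists (q * 'X_[b'] + refl e i j s 'X_[b] * q').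
    rewrite mulrDl (mulrAC q) -(mulrA _ q') -Hq -Hq' mulrBl mulrBr addrA subrK -!mpolyXD.
    congr (_ - _); rewrite !reflX -scalerAl -scalerAr scalerA -mpolyXD.
    congr (_ *: mpolyX _ _); last by apply/mnmP => k; rewrite !(mnmE, mnmDE).
    by rewrite /c !mnmDE !mulnDr !exprD mulrACA.
  have DU k : exists q, 'X_k - refl e i j s 'X_k = q * d.
    have pU : p U_(k)%MM = U_(tperm i j k)%MM.
      apply/mnmP => l; rewrite mnmE !mnm1E.
      by rewrite -(inj_eq (@perm_inj _ (tperm i j))) tpermK.
    rewrite reflX pU /c !mnm1E; case: tpermP => [->|->|/eqP ki /eqP kj].
    - exists 1; rewrite mul1r eqxx eq_sym (negbTE ji).
      by rewrite muln0 muln1 mulr1.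
    - exists (- (e^-1 ^+ s)%:MP); rewrite eqxx (negbTE ji) muln0 muln1 mul1r.
      rewrite mulNr mul_mpolyC scalerBr opprB scalerA -exprMn mulVf //.
      by rewrite expr1n scale1r.
    - exists 0; rewrite (negbTE ki) (negbTE kj) !muln0 mulr1 scale1r.
      by rewrite subrr mul0r.
  rewrite (multinomUE_id a); elim/big_ind: _ => // k _.
  by elim: (a k) => [|n IHn]; rewrite ?mulm0n // mulmS; apply: DD.
have [r rP] := choice XP.
exists (\sum_(a <- msupp f) f@_a *: r a).
rewrite mulr_suml {1}(mpolyE f).
have -> : refl e i j s f = \sum_(a <- msupp f) f@_a *: refl e i j s 'X_[a].
  apply/mpolyP => b; rewrite mcoeff_refl {1}(mpolyE f) !raddf_sum !mulr_suml.
  apply: eq_bigr => a _ /=.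
  by rewrite !mcoeffZ mcoeff_refl -!mulrA.
rewrite -sumrB; apply: eq_bigr => a _.
by rewrite -scalerBr -scalerAl; rewrite rP.
Qed.

Lemma sum_tau_dvd e m i t f : m.-primitive_root e -> (0 < t < m)%N ->
  exists q, \sum_(s < m) e ^- (s * t) *: iter s (tau e i) f = q * 'X_i.
Proof.
move=> e_prim /andP[t0 tm]; set P := \sum_(s < m) _.
have P0 (a : 'X_{1..N}) : a i = 0%N -> P@_a = 0.
  move=> ai; rewrite raddf_sum /=.
  under eq_bigr do rewrite mcoeffZ mcoeff_iter_tau ai muln0 mulr1 -exprVn.
  rewrite -mulr_suml; under eq_bigr do rewrite mulnC exprM.
  set z := e^-1 ^+ t.
  have z1 : z - 1 != 0.
    rewrite subr_eq0 /z exprVn invr_eq1 -(prim_order_dvd e_prim).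
    by apply/negP => /(dvdn_leq t0); rewrite leqNgt tm.
  have /eqP : z ^+ m - 1 = 0.
    by rewrite /z exprAC exprVn (prim_expr_order e_prim) invr1 expr1n subrr.
  by rewrite subrX1 mulf_eq0 (negbTE z1) /= => /eqP->; rewrite mul0r.
exists (\sum_(a <- msupp P) P@_a *: 'X_[(a - U_(i))%MM]).
rewrite mulr_suml {1}(mpolyE P) big_seq [RHS]big_seq.
apply: eq_bigr => a aP; rewrite -scalerAl -mpolyXD submK // lep1mP.
by apply/eqP => /P0 /eqP; rewrite mcoeff_eq0 aP.
Qed.

Lemma dunklE e m (kappa : m.-tuple F) i f : m.-primitive_root e ->
  tofrac (dunkl e kappa i f) = dunkl_frac e kappa i f.
Proof.
move=> e_prim; rewrite /dunkl; case: pselect => [ex_q|[]].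
  exact/eqP/(xchooseP ex_q).
have e0 : e != 0.
  by rewrite (prim_root_eq0 e_prim) -lt0n (prim_order_gt0 e_prim).
pose I := [pred z : {fraction {mpoly F[N]}} | `[< exists q, tofrac q == z >]].
have ID z z' : z \in I -> z' \in I -> z + z' \in I.
  move=> /asboolP[q /eqP<-] /asboolP[q' /eqP<-]; apply/asboolP.
  by exists (q + q'); rewrite tofracD.
have I0 : 0 \in I by apply/asboolP; exists 0; rewrite tofrac0.
have IM q z : z \in I -> tofrac q * z \in I.
  move=> /asboolP[q' /eqP<-]; apply/asboolP.
  by exists (q * q'); rewrite tofracM.
have Idvd n d : d != 0 -> (exists q, n = q * d) -> tofrac n / tofrac d \in I.
  move=> d0 [q ->]; apply/asboolP; exists q.
  by rewrite tofracM mulfK // tofrac_eq0.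
suff /asboolP : dunkl_frac e kappa i f \in I by [].
apply: (ID); first apply: (ID).
- by apply/asboolP; exists f^`M(i).
- apply: IM; elim/big_ind: _ => // j ji; elim/big_ind: _ => // s _.
  apply: Idvd; last exact: refl_dvd.
  apply/eqP => /(congr1 (mcoeff U_(i)%MM)) /eqP.
  rewrite mcoeffB mcoeffZ !mcoeffX eqxx mcoeff0.
  suff /negbTE-> : U_(j)%MM != U_(i)%MM by rewrite mulr0 subr0 oner_eq0.
  by apply: contra_neq ji => /mnmP/(_ j); rewrite !mnm1E eqxx; case: eqP.
- rewrite big_nat; elim/big_ind: _ => // t tm; apply: IM.
  rewrite -mulr_suml -rmorph_sum; apply: Idvd; last exact: sum_tau_dvd.
  by rewrite -msupp_eq0 msuppX.
Qed.

End Dunkl.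

(* Main.v *)
(* Write D for the Dunkl operator of S_N with parameter kappa_0 in the variables
   y_j = x_j^m, and V for the sum of the transpositions (i,j), j <> i.  On
   p = x_i^r (prod_{j <> i} x_j)^t h(y) with 0 <= r, t < m, the operator x_i T_i
   multiplies h by the operator
     m y_i D + [t < r] m kappa_0 V + r + [0 < r] m kappa_r,
   because summing the reflection quotients over the m-th roots of unity only
   leaves terms in x_i^m - x_j^m.  So T_i^m (x^(tv) h) lowers the exponent of
   x_i from t to 0, applies D once, and lowers it from m - 1 to t.  The relation
     D (m y_i D) = (m y_i D + m kappa_0 V + m) D
   moves the first t factors across D, turning kappa_r into kappa_r + 1 for
   1 <= r <= t, which is what T_i(kappa')^m does to h. *)
Require Import Defs.
From HB Require Import structures.
From mathcomp Require Import all_boot all_order all_algebra all_fingroup.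
From mathcomp Require Import fraction complex boolp reals.
From mathcomp Require Import mpoly.
From mathcomp Require trigo.
From mathcomp Require Import ring lra zify.

Set Implicit Arguments.
Unset Strict Implicit.
Unset Printing Implicit Defensive.

Import Order.TTheory GRing.Theory Num.Theory.
Local Open Scope ring_scope.


(** * The number eta as a primitive m-th root of unity *)

Lemma eta_mX (R : realType) (m n : nat) :
  eta_m R m ^+ n = Complex (trigo.cos (2 * trigo.pi / m%:R * n%:R))
                           (trigo.sin (2 * trigo.pi / m%:R * n%:R)).
Proof.
elim: n => [|n IHn]; first by rewrite mulr0 trigo.cos0 trigo.sin0.
set a := 2 * trigo.pi / m%:R in IHn *.
rewrite exprS IHn (_ : a * n.+1%:R = a + a * n%:R); last by rewrite -natr1; ring.
by rewrite trigo.cosD trigo.sinD /eta_m; congr Complex; ring.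
Qed.

(** If eta^k = 1 with 0 < k < m, real parts give cos (2 pi k / m) = 1, hence sin (pi k / m) = 0; but
    0 < pi k / m < pi makes this sine positive. *)
Lemma eta_m_prim (R : realType) (m : nat) : (0 < m)%N ->
  m.-primitive_root (eta_m R m).
Proof.
move=> m0; have mR0 : (m%:R : R) != 0 by rewrite pnatr_eq0 -lt0n.
apply/andP; split=> //; apply/forallP => -[k km] /=; apply/eqP.
rewrite unity_rootE eta_mX.
have [->|neq_km] := eqVneq k.+1 m.
  by rewrite divfK // mulr_natl trigo.cos2pi trigo.sin2pi; apply/eqP.
apply/negP => /eqP[/eqP + _].
have -> : 2 * trigo.pi / m%:R * k.+1%:R = (trigo.pi * (k.+1%:R / m%:R)) *+ 2 :> R.
  by rewrite -mulr_natl; ring.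
rewrite trigo.cos_mulr2n trigo.cos2sin2 => /eqP h.
have : 0 < trigo.sin (trigo.pi * (k.+1%:R / m%:R) : R).
  apply: trigo.sin_gt0_pi; rewrite mulr_gt0 ?trigo.pi_gt0 ?divr_gt0 ?ltr0n //=.
  rewrite gtr_pMr ?trigo.pi_gt0 // ltr_pdivrMr ?ltr0n // mul1r ltr_nat.
  by rewrite ltn_neqAle neq_km km.
set s := trigo.sin _ in h * => s0.
by have := exprn_gt0 2 s0; rewrite (_ : s ^+ 2 = 0) ?ltxx //; lra.
Qed.

(** * Sums over the m-th roots of unity in a field *)

Section FieldSums.
Variables (K : fieldType) (m : nat) (z : K).
Hypothesis z_prim : m.-primitive_root z.

Lemma sum_prim_rootX k :
  \sum_(s < m) z ^+ (s * k) = if (m %| k)%N then m%:R else 0.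
Proof.
under eq_bigr do rewrite mulnC exprM.
case: ifPn => [|mk].
  rewrite (prim_order_dvd z_prim) => /eqP ->.
  by under eq_bigr do rewrite expr1n; rewrite sumr_const card_ord.
have zk1 : z ^+ k - 1 != 0 by rewrite subr_eq0 -(prim_order_dvd z_prim).
apply: (mulfI zk1); rewrite mulr0 -subrX1 exprAC (prim_expr_order z_prim).
by rewrite expr1n subrr.
Qed.

Lemma prim_root_expVn s k : (k <= m)%N -> z^-1 ^+ (s * k) = z ^+ (s * (m - k)).
Proof.
move=> km; have zu : z ^+ (s * k) \is a GRing.unit.
  rewrite unitfE expf_neq0 // (prim_root_eq0 z_prim) -lt0n.
  exact: prim_order_gt0 z_prim.
apply: (mulrI zu); rewrite exprVn divrr // -exprD -mulnDr subnKC // mulnC exprM.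
by rewrite (prim_expr_order z_prim) expr1n.
Qed.

(** The common denominator is x^m - y^m = x^m - (z^s y)^m. The cofactor of x - z^s y expands into
    the monomials x^(m-1-n) y^n weighted by z^(sn), and summing over s keeps only n = l, the one n <
    m with m dividing k + n. *)
Lemma sum_prim_root_div x y k l : x ^+ m - y ^+ m != 0 -> (l < m)%N ->
  (m %| k + l)%N ->
  \sum_(s < m) z ^+ (s * k) / (x - z ^+ s * y)
  = m%:R * x ^+ (m.-1 - l) * y ^+ l / (x ^+ m - y ^+ m).
Proof.
move=> xy0 lm kl.
have step (s : 'I_m) : z ^+ (s * k) / (x - z ^+ s * y) =
    (\sum_(n < m) z ^+ (s * (k + n)) * (x ^+ (m.-1 - n) * y ^+ n))
    / (x ^+ m - y ^+ m).
  have xyE : x ^+ m - y ^+ m = (x - z ^+ s * y) *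
      \sum_(n < m) x ^+ (m.-1 - n) * (z ^+ s * y) ^+ n.
    by rewrite -subrXX exprMn exprAC (prim_expr_order z_prim) expr1n mul1r.
  have /andP[d0 S0] : (x - z ^+ s * y != 0) &&
      (\sum_(n < m) x ^+ (m.-1 - n) * (z ^+ s * y) ^+ n != 0).
    by rewrite -negb_or -mulf_eq0 -xyE.
  have -> : \sum_(n < m) z ^+ (s * (k + n)) * (x ^+ (m.-1 - n) * y ^+ n) =
      z ^+ (s * k) * \sum_(n < m) x ^+ (m.-1 - n) * (z ^+ s * y) ^+ n.
    rewrite mulr_sumr; apply: eq_bigr => n _.
    by rewrite mulnDr exprD exprMn -exprM; ring.
  by rewrite xyE invfM mulrA -mulrA [_^-1 / _]mulrC mulrA mulfK.
under eq_bigr do rewrite step.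
rewrite -mulr_suml exchange_big /=; congr (_ / _).
under eq_bigr do rewrite -mulr_suml sum_prim_rootX.
rewrite (bigD1 (Ordinal lm)) //= kl mulrA big1 ?addr0 // => n nl.
case: ifPn => [kn|]; last by rewrite mul0r.
case/eqP: nl; apply/val_inj => /=.
have : (k + n == k + l %[mod m])%N by rewrite (eqP kl) -(eqP kn).
by rewrite eqn_modDl !modn_small // => /eqP.
Qed.

(** In use, u collects the variables other than x_i and x_j, and H, H' are a polynomial in y and its
    transpose. *)
Lemma sum_reflection_quotients x y u H H' r t :
  x ^+ m - y ^+ m != 0 -> x != 0 -> (r < m)%N -> (t < m)%N ->
  x * (\sum_(s < m) (x ^+ r * y ^+ t * u * H
         - z ^+ (s * r) * z^-1 ^+ (s * t) * (x ^+ t * y ^+ r * u) * H')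
         / (x - z ^+ s * y))
  = m%:R * (x ^+ r * y ^+ t * u)
    * (x ^+ m * ((H - H') / (x ^+ m - y ^+ m)) + (if (t < r)%N then H' else 0)).
Proof.
move=> xy0 x0 rm tm.
(* [l] represents t - r modulo m, so it cancels the root exponent r + (m - t). *)
pose l := (if t < r then m + t - r else t - r)%N.
have lm : (l < m)%N by rewrite /l; case: ifP; lia.
have S0 := @sum_prim_root_div x y 0 0 xy0 (leq_ltn_trans (leq0n r) rm) (dvdn0 m).
have dl : (m %| (r + (m - t)) + l)%N.
  rewrite /l; case: ltnP => tr.
    have -> : (r + (m - t) + (m + t - r) = m * 2)%N by lia.
    exact: dvdn_mulr.
  by have -> : (r + (m - t) + (t - r) = m)%N by lia.
have S1 := sum_prim_root_div xy0 lm dl.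
have xm n : (n < m)%N -> x ^+ (m.-1 - n) = x ^+ (m - n) / x.
  move=> nm; rewrite (_ : (m - n)%N = (m.-1 - n).+1); last by lia.
  by rewrite exprSr mulfK.
transitivity (x * (x ^+ r * y ^+ t * u * H *
     (\sum_(s < m) z ^+ (s * 0) / (x - z ^+ s * y))
   - x ^+ t * y ^+ r * u * H' *
     (\sum_(s < m) z ^+ (s * (r + (m - t))) / (x - z ^+ s * y)))).
  rewrite !mulr_sumr -sumrB mulr_sumr; apply: eq_bigr => s _.
  rewrite muln0 expr0 (prim_root_expVn _ (ltnW tm)) mulnDr exprD.
  by rewrite mul1r; ring.
rewrite {}S0 {}S1 !xm ?(leq_ltn_trans (leq0n r) rm) // subn0 expr0.
(* For t < r the residue wraps around and y^m replaces x^m. Since x^m H - y^m H' = x^m (H - H') +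
   (x^m - y^m) H', this produces the extra H'. *)
have key : x ^+ (m - l) * x ^+ t * (y ^+ l * y ^+ r) =
    x ^+ r * y ^+ t * (if (t < r)%N then y ^+ m else x ^+ m).
  rewrite -!exprD /l; case: ltnP => tr.
    rewrite -mulrA -exprD; congr (x ^+ _ * y ^+ _); lia.
  rewrite mulrAC -exprD; congr (x ^+ _ * y ^+ _); lia.
transitivity ((m%:R * u * (x ^+ r * y ^+ t * x ^+ m * H
    - x ^+ (m - l) * x ^+ t * (y ^+ l * y ^+ r) * H')) / (x ^+ m - y ^+ m)).
  by field; rewrite x0 xy0.
by rewrite key; case: ifP => _; field.
Qed.

End FieldSums.

(** * Products of scalar shifts of one operator *)

Section ShiftedPowers.
Variables (F : fieldType) (V : lmodType F).
Implicit Types (A B D : V -> V) (b : nat -> F) (h : V).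

(** The factor of index r + n acts first and that of index r + 1 last, the order in which T_i lowers
    the exponent of x_i. *)
Fixpoint shift_prod A b (r n : nat) h : V :=
  if n is n'.+1 then shift_prod A b r n' (A h + b (r + n'.+1)%N *: h) else h.

Lemma shift_prodD A b r n1 n2 h :
  shift_prod A b r (n1 + n2) h
  = shift_prod A b r n1 (shift_prod A b (r + n1) n2 h).
Proof.
by elim: n2 h => [|n2 IHn] h; rewrite ?addn0 // addnS /= IHn addnS addnA addnS.
Qed.

Lemma eq_shift_prod A b b' r n h :
  (forall k, (r < k <= r + n)%N -> b k = b' k) ->
  shift_prod A b r n h = shift_prod A b' r n h.
Proof.
elim: n h => //= n IHn h bb'; rewrite bb'; last by lia.
by apply: IHn => k hk; apply: bb'; lia.
Qed.

Lemma shift_prod_comm1 (A : {linear V -> V}) b r n c h :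
  shift_prod A b r n (A h + c *: h)
  = A (shift_prod A b r n h) + c *: shift_prod A b r n h.
Proof.
elim: n h => //= n IHn h; rewrite -IHn; congr shift_prod.
rewrite ![A (_ + _)]linearD ![A (_ *: _)]linearZ /= !scalerDr !scalerA (mulrC c) !addrA.
congr (_ + _).
by rewrite addrAC.
Qed.

(** Both products are polynomials in the same linear operator. *)
Lemma shift_prod_comm (A : {linear V -> V}) b b' r n r' n' h :
  shift_prod A b r n (shift_prod A b' r' n' h)
  = shift_prod A b' r' n' (shift_prod A b r n h).
Proof. by elim: n' h => //= n' IHn h; rewrite IHn shift_prod_comm1. Qed.

Lemma shift_prodZ (A : {linear V -> V}) b r n c h :
  c *: shift_prod A b r n h = shift_prod A b r n (c *: h).
Proof.
elim: n h => //= n IHn h; rewrite IHn; congr shift_prod.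
by rewrite [A (_ *: _)]linearZ /= scalerDr !scalerA mulrC.
Qed.

Lemma shift_prod_intertwine A B D b b' r n h :
  (forall k f, (r < k <= r + n)%N ->
     D (A f + b k *: f) = B (D f) + b' k *: D f) ->
  D (shift_prod A b r n h) = shift_prod B b' r n (D h).
Proof.
elim: n h => //= n IHn h AB; rewrite IHn => [|k f hk]; last by apply: AB; lia.
by rewrite AB //; lia.
Qed.

End ShiftedPowers.


(** * Multiplicativity of tau_i and of the reflections *)

Section Reflections.
Variables (F : fieldType) (N : nat).
Implicit Types (e c : F) (f g h : {mpoly F[N]}) (i j k : 'I_N).

(** Seen as a substitution, tau_i is a ring morphism, which its coefficientwise definition hides. *)
Lemma tauE e i f :
  tau e i f = f \mPo [tuple (if k == i then e else 1) *: 'X_k | k < N].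
Proof.
rewrite comp_mpolyEX; apply: eq_bigr => a _.
rewrite -scalerA; congr (_ *: _); rewrite comp_mpolyX.
under eq_bigr do rewrite tnth_mktuple exprZn.
rewrite scaler_prod -mpolyXE_id; congr (_ *: _).
rewrite (bigD1 i) //= eqxx big1 ?mulr1 // => k /negbTE ->.
by rewrite expr1n.
Qed.

Lemma tauM e i f g : tau e i (f * g) = tau e i f * tau e i g.
Proof. by rewrite !tauE rmorphM. Qed.

Lemma iter_tauM e i s f g :
  iter s (tau e i) (f * g) = iter s (tau e i) f * iter s (tau e i) g.
Proof. by elim: s => //= s ->; rewrite tauM. Qed.

Lemma iter_tauX e i s (a : 'X_{1..N}) :
  iter s (tau e i) 'X_[a] = e ^+ (s * a i) *: 'X_[a].
Proof.
apply/mpolyP => b; rewrite mcoeff_iter_tau mcoeffZ mcoeffX.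
by case: eqP => [->|_]; rewrite ?mul1r ?mulr1 // mul0r mulr0.
Qed.

Lemma reflM e i j s f g : refl e i j s (f * g) = refl e i j s f * refl e i j s g.
Proof. by rewrite /refl iter_tauM msymM iter_tauM. Qed.

Lemma reflX e i j s (a : 'X_{1..N}) :
  refl e i j s 'X_[a] = (e ^+ (s * a i) * e^-1 ^+ (s * a j))
                        *: 'X_[[multinom a (tperm i j k) | k < N]].
Proof.
have pK : involutive (fun b : 'X_{1..N} => [multinom b (tperm i j k) | k < N]).
  by move=> b; apply/mnmP => k; rewrite !mnmE tpermK.
apply/mpolyP => b; rewrite mcoeff_refl mcoeffZ !mcoeffX.
rewrite (inv_eq pK); case: eqP => [->|_]; last by rewrite mulr0 !mul0r.
by rewrite mul1r mulr1 !mnmE tpermL tpermR.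
Qed.

(** * Polynomials in y_k = x_k^m *)

Section PowerSubstitution.
Variable m : nat.

Definition subst_pow : {mpoly F[N]} -> {mpoly F[N]} :=
  comp_mpoly [tuple 'X_k ^+ m | k < N].

Lemma subst_powD f g : subst_pow (f + g) = subst_pow f + subst_pow g.
Proof. exact: comp_mpolyD. Qed.

Lemma subst_powB f g : subst_pow (f - g) = subst_pow f - subst_pow g.
Proof. exact: comp_mpolyB. Qed.

Lemma subst_pow0 : subst_pow 0 = 0.
Proof. exact: comp_mpoly0. Qed.

Lemma subst_powZ c f : subst_pow (c *: f) = c *: subst_pow f.
Proof. exact: comp_mpolyZ. Qed.

Lemma subst_powM f g : subst_pow (f * g) = subst_pow f * subst_pow g.
Proof. exact: rmorphM. Qed.

Lemma subst_pow_sum (I : Type) (r : seq I) (P : pred I) (G : I -> {mpoly F[N]}) :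
  subst_pow (\sum_(k <- r | P k) G k) = \sum_(k <- r | P k) subst_pow (G k).
Proof. exact: raddf_sum. Qed.

Lemma subst_powX (a : 'X_{1..N}) : subst_pow 'X_[a] = 'X_[(a *+ m)%MM].
Proof.
rewrite /subst_pow comp_mpolyX mpolyXE_id; apply: eq_bigr => k _.
by rewrite tnth_mktuple mulmnE -exprM mulnC.
Qed.

Lemma subst_powE h : subst_pow h = \sum_(a <- msupp h) h@_a *: 'X_[(a *+ m)%MM].
Proof.
rewrite /subst_pow comp_mpolyEX; apply: eq_bigr => a _.
by rewrite -[_ \mPo _]/(subst_pow _) subst_powX.
Qed.

Lemma iter_tau_subst_pow e i s h : e ^+ m = 1 ->
  iter s (tau e i) (subst_pow h) = subst_pow h.
Proof.
move=> em; apply/mpolyP => b; rewrite mcoeff_iter_tau.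
rewrite subst_powE !raddf_sum /= mulr_suml; apply: eq_bigr => a _.
rewrite mcoeffZ mcoeffX; case: eqP => [<-|_]; last by rewrite mulr0 mul0r.
by rewrite mulmnE mulnC -mulnA mulnCA exprM em expr1n !mulr1.
Qed.

Lemma msym_subst_pow (p : {perm 'I_N}) h :
  msym p (subst_pow h) = subst_pow (msym p h).
Proof.
elim/mpolyind: h => [|c a h _ _ IHh]; first by rewrite !(msym0, subst_pow0).
set X := 'X_[a]; rewrite (subst_powD (c *: X) h) (subst_powZ c X).
rewrite (msymD p (c *: X) h) (msymZ c X p) (subst_powD (c *: msym p X)).
rewrite (subst_powZ c (msym p X)) (msymD p (c *: subst_pow X)) msymZ IHh {}/X.
rewrite !msymX !subst_powX msymX; congr (_ *: 'X_[_] + _).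
by apply/mnmP => k; rewrite !(mnmE, mulmnE).
Qed.

(** The twists by tau_i are invisible on polynomials in y, so the m reflections attached to i and j
    all act as one transposition of the y_k. *)
Lemma refl_subst_pow e i j s h : e ^+ m = 1 ->
  refl e i j s (subst_pow h) = subst_pow (msym (tperm i j) h).
Proof.
move=> em; rewrite /refl iter_tau_subst_pow // msym_subst_pow.
by rewrite iter_tau_subst_pow // exprVn em invr1.
Qed.

(** Chain rule x_i d/dx_i = m y_i d/dy_i; the factor x_i avoids the exponent m - 1. *)
Lemma mderiv_subst_pow i h :
  'X_i * (subst_pow h)^`M(i) = m%:R *: ('X_i ^+ m * subst_pow h^`M(i)).
Proof.
elim/mpolyind: h => [|c a h _ _ IHh].
  by rewrite subst_pow0 !mderiv0 subst_pow0 !mulr0 scaler0.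
rewrite subst_powD subst_powZ 2!mderivD 2!mderivZ subst_powD subst_powZ.
rewrite !mulrDr scalerDr IHh.
congr (_ + _); rewrite subst_powX !mderivX subst_powZ subst_powX.
rewrite -!scalerAr mpolyXn -!mpolyXD !scalerA mulmnE.
have -> : m%:R * (c * (a i)%:R) = c * (a i * m)%:R by rewrite natrM; ring.
(* When a_i m = 0, truncated subtraction breaks the identity of exponents, but the coefficient
   vanishes. *)
have [->|am0] := posnP (a i * m)%N; first by rewrite mulr0 !scale0r.
congr (_ *: 'X_[_]); apply/mnmP => k; rewrite !(mnmDE, mnmBE, mulmnE, mnm1E).
case: eqP => [<-|_]; last by rewrite mul0n !subn0.
rewrite mul1n mulnBl mul1n !subnKC //.
by move: am0; rewrite muln_gt0 => /andP[ai0 _]; rewrite leq_pmull.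
Qed.

End PowerSubstitution.
End Reflections.


(** * The Dunkl operator of S_N and its commutator with x_i *)

Section SymmetricDunkl.
Variables (F : fieldType) (N : nat) (c : F) (i : 'I_N).
Implicit Types (f g h : {mpoly F[N]}) (j : 'I_N).

Lemma mpolyXn_sub_neq0 m j b : (0 < m)%N -> j != i ->
  'X_i ^+ m - b *: 'X_j ^+ m != 0 :> {mpoly F[N]}.
Proof.
move=> m0 ji; apply/eqP => /(congr1 (mcoeff (U_(i) *+ m)%MM)) /eqP.
rewrite mcoeffB mcoeffZ !mpolyXn !mcoeffX eqxx mcoeff0.
suff /negbTE-> : (U_(j) *+ m)%MM != (U_(i) *+ m)%MM by rewrite mulr0 subr0 oner_eq0.
apply: contra_neq ji => /mnmP/(_ j); rewrite !mulmnE !mnm1E eqxx.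
by case: eqP => //; rewrite mul0n mul1n => _ m0'; rewrite m0' in m0.
Qed.

Lemma mpolyX_sub_neq0 j : j != i -> 'X_i - 'X_j != 0 :> {mpoly F[N]}.
Proof. by move=> /(mpolyXn_sub_neq0 1 (ltn0Sn 0)); rewrite scale1r. Qed.

(* For m = 1 and eta = 1 the definition of T_i specializes to S_N. *)
Definition sym_dunkl (h : {mpoly F[N]}) : {mpoly F[N]} := dunkl 1 [tuple c] i h.

Definition swaps (h : {mpoly F[N]}) : {mpoly F[N]} :=
  \sum_(j < N | j != i) msym (tperm i j) h.

(** Exhibits the divided differences as polynomials, so that D can be handled outside the fraction
    field. For m = 1 the tau terms form an empty sum. *)
Lemma sym_dunklE h : exists q : 'I_N -> {mpoly F[N]},
  (forall j, j != i -> h - msym (tperm i j) h = q j * ('X_i - 'X_j)) /\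
  sym_dunkl h = h^`M(i) + c *: \sum_(j < N | j != i) q j.
Proof.
have prim1 : 1.-primitive_root (1 : F).
  by apply/andP; split=> //; apply/forallP => j; rewrite (ord1 j) unity_rootE expr1 eqxx.
have /boolp.choice[q qP] : forall j, exists q : {mpoly F[N]},
    j != i -> h - msym (tperm i j) h = q * ('X_i - 'X_j).
  (* The placeholder 0 at j = i lies outside the range of summation. *)
  move=> j; case: (boolP (j == i)) => [ji|ji]; first by exists 0.
  have [q] := refl_dvd 0 h (oner_neq0 F) ji.
  by rewrite expr0 scale1r => hq; exists q => _.
exists q; split=> //; apply/eqP; rewrite -tofrac_eq dunklE //; apply/eqP.
rewrite /dunkl_frac (@big_geq _ _ _ 1 1) // addr0 tofracD -mul_mpolyC tofracM.
congr (_ + _ * _); rewrite rmorph_sum; apply: eq_bigr => j ji.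
rewrite big_ord1 expr0 scale1r [refl _ _ _ _ _]/(msym (tperm i j) h) qP //.
by rewrite tofracM mulfK // tofrac_eq0 mpolyX_sub_neq0.
Qed.

Fact sym_dunkl_is_linear : linear sym_dunkl.
Proof.
move=> a f g.
have [q [qP ->]] := sym_dunklE (a *: f + g).
have [qf [qfP ->]] := sym_dunklE f; have [qg [qgP ->]] := sym_dunklE g.
(* The quotients were chosen independently for the three polynomials; cancelling the nonzero x_i -
   x_j relates them. *)
have -> : \sum_(j < N | j != i) q j = \sum_(j < N | j != i) (a *: qf j + qg j).
  apply: eq_bigr => j ji; apply: (mulIf (mpolyX_sub_neq0 ji)).
  rewrite -qP // mulrDl -scalerAl -qfP // -qgP // msymD msymZ scalerBr.
  by rewrite opprD addrACA.
rewrite big_split /= -scaler_sumr mderivD mderivZ !scalerDr !scalerA (mulrC c).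
by rewrite addrACA.
Qed.

HB.instance Definition _ := GRing.isLinear.Build F {mpoly F[N]} {mpoly F[N]} _
  sym_dunkl sym_dunkl_is_linear.

(** In x_i h - x_j (i,j)h = (x_i - x_j) (i,j)h + x_i (h - (i,j)h), the first term contributes (i,j)h
    to the quotient; summed over j, this is the swap term. *)
Lemma sym_dunklXM h :
  sym_dunkl ('X_i * h) = h + 'X_i * sym_dunkl h + c *: swaps h.
Proof.
have [q [qP ->]] := sym_dunklE ('X_i * h); have [r [rP ->]] := sym_dunklE h.
have -> : \sum_(j < N | j != i) q j =
    \sum_(j < N | j != i) (msym (tperm i j) h + 'X_i * r j).
  apply: eq_bigr => j ji; apply: (mulIf (mpolyX_sub_neq0 ji)).
  rewrite -qP // mulrDl -mulrA -rP // msymM msymX.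
  have -> : [multinom U_(i)%MM ((tperm i j)^-1%g k) | k < N] = U_(j)%MM.
    apply/mnmP => k; rewrite mnmE !mnm1E tpermV.
    by rewrite -(inj_eq (@perm_inj _ (tperm i j))) tpermK tpermL.
  by rewrite mulrBr mulrBr mulrC [_ * 'X_j]mulrC; ring.
rewrite big_split /= -mulr_sumr mderivM mderivX mnm1E eqxx scale1r.
have -> : (U_(i) - U_(i))%MM = 0%MM :> 'X_{1..N}.
  by apply/mnmP => k; rewrite mnmBE subnn mnm0E.
rewrite mpolyX0 mul1r scalerDr mulrDr -scalerAr.
by rewrite -/(swaps h) !addrA addrAC.
Qed.

Fact swaps_is_linear : linear swaps.
Proof.
move=> a f g.
rewrite /swaps scaler_sumr -big_split; apply: eq_bigr => j _.
by rewrite msymD msymZ.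
Qed.

HB.instance Definition _ := GRing.isLinear.Build F {mpoly F[N]} {mpoly F[N]} _
  swaps swaps_is_linear.

End SymmetricDunkl.


(** * One application of x_i T_i to a monomial times h(y) *)

Section DunklStep.
Variables (F : fieldType) (N m : nat) (e : F) (i : 'I_N).
Hypothesis e_prim : m.-primitive_root e.
Implicit Types (f g h : {mpoly F[N]}) (j : 'I_N) (kappa : m.-tuple F).

Definition const_frac : {rmorphism F -> {fraction {mpoly F[N]}}} :=
  (@tofrac {mpoly F[N]} \o @mpolyC N F).

Lemma tofracZ a f : tofrac (a *: f) = const_frac a * tofrac f.
Proof. by rewrite -mul_mpolyC tofracM. Qed.

Lemma const_frac_prim : m.-primitive_root (const_frac e).
Proof. by rewrite fmorph_primitive_root. Qed.

(* The exponent of x_i^r (prod_{j <> i} x_j)^t. *)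
Definition split_mnm (r t : nat) : 'X_{1..N} :=
  [multinom (if k == i then r else t) | k < N].

(** [w] collects the variables whose exponents the transposition fixes: the factor u of
    [sum_reflection_quotients]. *)
Lemma split_mnm_swap j r t : j != i -> exists w : 'X_{1..N},
  'X_[split_mnm r t] = 'X_i ^+ r * 'X_j ^+ t * 'X_[w] :> {mpoly F[N]} /\
  'X_[[multinom split_mnm r t (tperm i j k) | k < N]]
    = 'X_i ^+ t * 'X_j ^+ r * 'X_[w] :> {mpoly F[N]}.
Proof.
move=> ji; exists [multinom (if (k == i) || (k == j) then 0 else t)%N | k < N].
rewrite !mpolyXn -!mpolyXD.
split; congr 'X_[_]; apply/mnmP => k; rewrite !(mnmE, mnmDE, mulmnE, mnm1E).
  rewrite ![_ == k]eq_sym; case: (eqVneq k i) => [->|ki] /=.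
    by rewrite eq_sym (negbTE ji); lia.
  by case: eqP => _; lia.
rewrite ![_ == k]eq_sym; case: tpermP => [->|->|/eqP/negbTE -> /eqP/negbTE ->].
- by rewrite eqxx (negbTE ji) eq_sym (negbTE ji) /=; lia.
- by rewrite !eqxx (negbTE ji) /=; lia.
- by rewrite /=; lia.
Qed.

Lemma prim_expm : e ^+ m = 1. Proof. exact: prim_expr_order. Qed.

Lemma tofracX_neq0 j : tofrac ('X_j : {mpoly F[N]}) != 0.
Proof. by rewrite tofrac_eq0 -msupp_eq0 msuppX. Qed.

Lemma dunkl_reflection_term r t h j (q : {mpoly F[N]}) :
  (r < m)%N -> (t < m)%N -> j != i ->
  h - msym (tperm i j) h = q * ('X_i - 'X_j) ->
  let p := 'X_[split_mnm r t] * subst_pow m h in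
  tofrac 'X_i * (\sum_(s < m) tofrac (p - refl e i j s p)
                                / tofrac ('X_i - e ^+ s *: 'X_j))
  = tofrac (m%:R *: ('X_[split_mnm r t] *
      subst_pow m ('X_i * q + (if (t < r)%N then msym (tperm i j) h else 0)))).
Proof.
move=> rm tm ji hq p.
have m0 : (0 < m)%N := prim_order_gt0 e_prim.
have [w [wE w'E]] := split_mnm_swap r t ji.
set x := tofrac 'X_i; pose y := tofrac ('X_j : {mpoly F[N]}).
have xy0 : x ^+ m - y ^+ m != 0.
  rewrite -!tofracXn -tofracB tofrac_eq0.
  by have := mpolyXn_sub_neq0 (1 : F) m0 ji; rewrite scale1r.
(* After x_k -> x_k^m, the hypothesis on [q] identifies (H - H') / (x^m - y^m) with q(y). *)
have qE : tofrac (subst_pow m q) =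
    (tofrac (subst_pow m h) - tofrac (subst_pow m (msym (tperm i j) h)))
    / (x ^+ m - y ^+ m).
  apply: (mulIf xy0); rewrite divfK // -tofracB -subst_powB hq subst_powM.
  rewrite subst_powB !subst_powX -!mpolyXn.
  by rewrite -!tofracXn -tofracB -tofracM.
have reflp s : tofrac (refl e i j s p) =
    const_frac e ^+ (s * r) * (const_frac e)^-1 ^+ (s * t)
    * (x ^+ t * y ^+ r * tofrac 'X_[w])
    * tofrac (subst_pow m (msym (tperm i j) h)).
  rewrite /p reflM reflX (refl_subst_pow _ _ _ _ prim_expm) w'E tofracM tofracZ.
  rewrite !tofracM !tofracXn -/x -/y rmorphM !rmorphXn fmorphV.
  by rewrite /split_mnm !mnmE eqxx (negbTE ji).
have dE s : tofrac ('X_i - e ^+ s *: 'X_j) = x - const_frac e ^+ s * y.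
  by rewrite tofracB tofracZ rmorphXn.
have pE : tofrac p = x ^+ r * y ^+ t * tofrac 'X_[w] * tofrac (subst_pow m h).
  by rewrite /p wE !tofracM !tofracXn.
under eq_bigr do rewrite tofracB reflp dE pE.
rewrite (sum_reflection_quotients const_frac_prim _ _ _ xy0 (tofracX_neq0 i)) //.
rewrite -qE tofracZ rmorph_nat tofracM wE !tofracM !tofracXn -!/x -!/y -!mulrA.
do 4!congr (_ * _); rewrite subst_powD tofracD subst_powM tofracM subst_powX.
rewrite -mpolyXn tofracXn -/x; congr (_ + _).
by case: ifP => // _; rewrite subst_pow0 tofrac0.
Qed.

(** [p] is an eigenvector of tau_i with eigenvalue e^r, so summing over s selects n = r; for r = 0
    no index n >= 1 matches. *)
Lemma dunkl_tau_term kappa r t h : (r < m)%N ->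
  let p := 'X_[split_mnm r t] * subst_pow m h in
  tofrac 'X_i * (\sum_(1 <= n < m) tofrac (kappa`_n)%:MP *
    \sum_(s < m) tofrac (e ^- (s * n) *: iter s (tau e i) p) / tofrac 'X_i)
  = tofrac ((if (0 < r)%N then m%:R * kappa`_r else 0) *: p).
Proof.
move=> rm p; rewrite mulr_sumr.
have tauP s : iter s (tau e i) p = e ^+ (s * r) *: p.
  rewrite /p iter_tauM iter_tauX (iter_tau_subst_pow _ _ _ prim_expm).
  by rewrite -scalerAl /split_mnm mnmE eqxx.
transitivity (\sum_(1 <= n < m) if n == r then
    const_frac (m%:R * kappa`_n) * tofrac p else 0); last first.
  rewrite -big_mkcond big_nat1_eq rm andbT tofracZ.
  by case: ifP => // _; rewrite rmorph0 mul0r.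
apply: eq_big_nat => n /andP[n1 nm].
have sumE : \sum_(s < m) e ^+ (s * r) * e ^- (s * n) = if n == r then m%:R else 0.
  under eq_bigr do rewrite -exprVn (prim_root_expVn e_prim _ (ltnW nm)) -exprD -mulnDr.
  rewrite (sum_prim_rootX e_prim); congr (if _ then _ else _).
  apply/idP/eqP => [|<-]; last by rewrite subnKC // ltnW.
  (* As r + (m - n) lies strictly between 0 and 2m, it can only be m. *)
  by move=> /dvdnP[[|[|k]]]; nia.
under eq_bigr do rewrite tauP scalerA.
rewrite -mulr_suml -rmorph_sum -scaler_suml.
under eq_bigr do rewrite mulrC.
rewrite sumE mulrCA [tofrac 'X_i * _]mulrC divfK ?tofracX_neq0 //.
case: ifP => _ /=; last by rewrite scale0r tofrac0 mulr0.
rewrite -[tofrac (kappa`_n)%:MP]/(const_frac _) tofracZ mulrA -rmorphM.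
by rewrite (mulrC (kappa`_n)).
Qed.


(** The factor x_i clears the denominator x_i and keeps the monomial unchanged. The derivative gives
    r and m y_i d/dy_i, the reflections complete m y_i D and add V, and the tau terms give m
    kappa_r. *)
Lemma dunkl_step kappa r t h : (r < m)%N -> (t < m)%N ->
  'X_i * dunkl e kappa i ('X_[split_mnm r t] * subst_pow m h)
  = 'X_[split_mnm r t] * subst_pow m (
      m%:R *: ('X_i * sym_dunkl kappa`_0 i h)
      + (if (t < r)%N then (m%:R * kappa`_0) *: swaps i h else 0)
      + (r%:R + (if (0 < r)%N then m%:R * kappa`_r else 0)) *: h).
Proof.
move=> rm tm; set p := 'X_[_] * subst_pow m h.
apply/eqP; rewrite -tofrac_eq tofracM dunklE // /dunkl_frac !mulrDr.
rewrite (dunkl_tau_term kappa t h rm).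
have [q [qP ->]] := sym_dunklE kappa`_0 i h.
rewrite mulrCA mulr_sumr.
under eq_bigr => j ji do rewrite (dunkl_reflection_term rm tm ji (qP j ji)).
rewrite -rmorph_sum -!tofracM -!tofracD tofrac_eq; apply/eqP.
rewrite mul_mpolyC.
have -> : 'X_i * p^`M(i) = r%:R *: p
    + 'X_[split_mnm r t] * (m%:R *: ('X_i ^+ m * subst_pow m h^`M(i))).
  rewrite -mderiv_subst_pow /p mderivM mderivX mulrDr; congr (_ + _); last by ring.
  rewrite -!scalerAl -!scalerAr mulrA -mpolyXD {1}/split_mnm mnmE eqxx.
  have [->|r0] := posnP r; first by rewrite !scale0r.
  congr (_ *: ('X_[_] * _)); apply/mnmP => k; rewrite !(mnmDE, mnmBE, mnmE, mnm1E).
  by rewrite [i == k]eq_sym; case: eqP => _; lia.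
rewrite -scaler_sumr -mulr_sumr -subst_pow_sum big_split -mulr_sumr /=.
have -> : \sum_(j < N | j != i) (if (t < r)%N then msym (tperm i j) h else 0)
    = if (t < r)%N then swaps i h else 0.
  by case: ifP => // _; rewrite big1.
rewrite !subst_powD !subst_powZ !subst_powM.
rewrite [subst_pow m (_ + _)]subst_powD subst_powZ subst_powX -mpolyXn /p.
have -> : subst_pow m (if (t < r)%N then (m%:R * kappa`_0) *: swaps i h else 0)
    = (m%:R * kappa`_0) *: subst_pow m (if (t < r)%N then swaps i h else 0).
  by case: ifP => _; rewrite -subst_powZ ?scaler0.
move: (subst_pow m _) (subst_pow m _) (subst_pow m _) (subst_pow m _) => A B C D.
move: ('X_[_]) ('X_i) (if _ then _ else _) kappa`_0 => X Y k k0.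
rewrite -!mul_mpolyC !mpolyCD !mpolyCM.
move: (m%:R%:MP) (r%:R%:MP) (k%:MP) (k0%:MP) => m' r' k' k0'.
ring.
Qed.

End DunklStep.


(** * The m-th power of T_i *)

Section DunklPower.
Variables (F : fieldType) (N m : nat) (e : F) (i : 'I_N).
Hypothesis e_prim : m.-primitive_root e.
Implicit Types (f g h : {mpoly F[N]}) (kappa : m.-tuple F).

Lemma split_mnmS r t : 'X_[split_mnm i r.+1 t]
  = 'X_i * 'X_[split_mnm i r t] :> {mpoly F[N]}.
Proof.
rewrite -mpolyXD; congr 'X_[_]; apply/mnmP => k.
by rewrite mnmDE !mnmE [i == k]eq_sym; case: eqP => _; lia.
Qed.

Lemma mpolyX_neq0 : 'X_i != 0 :> {mpoly F[N]}.
Proof. by rewrite -msupp_eq0 msuppX. Qed.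

(** Apart from scalars, x_i T_i acts on h by [step_low] while the exponent of x_i is at most t, and
    by [step_high] above t. *)
Definition step_low (c : F) h : {mpoly F[N]} := m%:R *: ('X_i * sym_dunkl c i h).

Definition step_high (c : F) h : {mpoly F[N]} :=
  m%:R *: ('X_i * sym_dunkl c i h) + (m%:R * c) *: swaps i h.

Definition step_shift kappa (k : nat) : F := k%:R + m%:R * kappa`_k.

Lemma dunkl_stepS kappa r t h : (r.+1 < m)%N -> (t < m)%N ->
  dunkl e kappa i ('X_[split_mnm i r.+1 t] * subst_pow m h)
  = 'X_[split_mnm i r t] * subst_pow m
      ((if (t < r.+1)%N then step_high else step_low) kappa`_0 h
       + step_shift kappa r.+1 *: h).
Proof.
move=> rm tm; apply: (mulfI mpolyX_neq0).
rewrite (dunkl_step _ e_prim) // mulrA -split_mnmS; congr (_ * subst_pow m _).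
by rewrite /step_high /step_low; case: ifP; rewrite ?addr0.
Qed.

(** At exponent 0, x_i T_i acts as m y_i D; dividing y_i = x_i^m by x_i raises the exponent to m - 1
    and leaves m D. *)
Lemma dunkl_step0 kappa t h : (t < m)%N ->
  dunkl e kappa i ('X_[split_mnm i 0 t] * subst_pow m h)
  = 'X_[split_mnm i m.-1 t] * subst_pow m (m%:R *: sym_dunkl kappa`_0 i h).
Proof.
move=> tm; have m0 := prim_order_gt0 e_prim; apply: (mulfI mpolyX_neq0).
rewrite (dunkl_step _ e_prim) //= !addr0 scale0r addr0 !subst_powZ subst_powM.
rewrite mulrA -split_mnmS (ltn_predK m0) subst_powX -mpolyXn -!scalerAr mulrA.
congr (_ *: (_ * _)); rewrite mpolyXn -mpolyXD; congr 'X_[_]; apply/mnmP => k.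
by rewrite mnmDE mulmnE mnm1E !mnmE [i == k]eq_sym; case: eqP => _; lia.
Qed.

Lemma iter_dunkl_step (A : {mpoly F[N]} -> {mpoly F[N]}) b kappa r n t h :
  (forall k f, (r <= k < r + n)%N ->
     dunkl e kappa i ('X_[split_mnm i k.+1 t] * subst_pow m f)
     = 'X_[split_mnm i k t] * subst_pow m (A f + b k.+1 *: f)) ->
  iter n (dunkl e kappa i) ('X_[split_mnm i (r + n) t] * subst_pow m h)
  = 'X_[split_mnm i r t] * subst_pow m (shift_prod A b r n h).
Proof.
elim: n h => [|n IHn] h step; first by rewrite addn0.
rewrite iterSr addnS step; last by lia.
by rewrite IHn => [|k f kn]; [rewrite /= addnS | apply: step; lia].
Qed.

Lemma iter_dunkl kappa t h : (t < m)%N ->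
  iter m (dunkl e kappa i) ('X_[split_mnm i t t] * subst_pow m h)
  = 'X_[split_mnm i t t] * subst_pow m
      (shift_prod (step_high kappa`_0) (step_shift kappa) t (m.-1 - t)
        (m%:R *: sym_dunkl kappa`_0 i
          (shift_prod (step_low kappa`_0) (step_shift kappa) 0 t h))).
Proof.
(* Read from the right: t steps down to exponent 0, one wrap to m - 1, and m - 1 - t steps down to
   t. *)
move=> tm; rewrite -[X in iter X](_ : (m.-1 - t + (1 + t) = m)%N); last by lia.
rewrite !iterD.
have -> : iter t (dunkl e kappa i) ('X_[split_mnm i t t] * subst_pow m h)
    = 'X_[split_mnm i 0 t] * subst_pow m
        (shift_prod (step_low kappa`_0) (step_shift kappa) 0 t h).
  by apply: (@iter_dunkl_step _ _ _ 0) => k f kt; rewrite dunkl_stepS ?ifF //; lia.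
rewrite [iter 1 _ _]/= dunkl_step0 //.
rewrite -[X in split_mnm i X t](_ : (t + (m.-1 - t) = m.-1)%N); last by lia.
apply: (@iter_dunkl_step (step_high kappa`_0) (step_shift kappa)).
by move=> k f kt; rewrite dunkl_stepS ?ifT //; lia.
Qed.

Fact step_high_is_linear c : linear (step_high c).
Proof.
move=> a f g; rewrite /step_high !linearP /= mulrDr -scalerAr !scalerDr.
rewrite !scalerA ![a * _]mulrC -!addrA; congr (_ + _).
by rewrite addrCA.
Qed.

HB.instance Definition _ c := GRing.isLinear.Build F {mpoly F[N]} {mpoly F[N]} _
  (step_high c) (step_high_is_linear c).

(** [sym_dunklXM] applied to D h gives D y_i D = (1 + y_i D + c V) D; times m, the last two terms
    form [step_high] and the 1 adds m to the scalar. *)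
Lemma sym_dunkl_step_low c b h :
  sym_dunkl c i (step_low c h + b *: h)
  = step_high c (sym_dunkl c i h) + (b + m%:R) *: sym_dunkl c i h.
Proof.
rewrite /step_low linearD !linearZ /= sym_dunklXM /step_high.
rewrite !scalerDr !scalerA [(b + _) *: _]scalerDl.
set u := m%:R *: sym_dunkl _ _ _; set v := m%:R *: (_ * _).
by rewrite -!addrA [LHS]addrC -!addrA.
Qed.

Lemma iter_dunkl_shift kappa t g : (1 <= t <= m - 1)%N ->
  iter m (dunkl e kappa i) ('X_[split_mnm i t t] * subst_pow m g)
  = 'X_[split_mnm i t t]
    * iter m (dunkl e (kappa_shift t kappa) i) (subst_pow m g).
Proof.
move=> ht; set kappa' := kappa_shift t kappa.
have m0 := prim_order_gt0 e_prim.
have kE k : (k < m)%N ->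
    kappa'`_k = if (1 <= k <= t)%N then kappa`_k + 1 else kappa`_k.
  by move=> km; rewrite -[k]/(val (Ordinal km)) -tnth_nth tnth_mktuple.
have k0E : kappa'`_0 = kappa`_0 by rewrite kE.
clearbody kappa'.
(* Raising kappa_k by 1 adds m to the scalar, just what D picks up in passing a factor. *)
have shift_low k : (0 < k <= t)%N ->
    step_shift kappa' k = step_shift kappa k + m%:R.
  by move=> kt; rewrite /step_shift kE ?kt ?mulrDr ?mulr1 ?addrA //; lia.
have shift_high k : (t < k <= t + (m.-1 - t))%N ->
    step_shift kappa k = step_shift kappa' k.
  by move=> kt; rewrite /step_shift kE ?ifF //; lia.
have split00 : 'X_[split_mnm i 0 0] = 1 :> {mpoly F[N]}.
  rewrite -mpolyX0; congr 'X_[_]; apply/mnmP => k.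
  by rewrite mnmE mnm0E if_same.
have tm : (t < m)%N by lia.
(* The right-hand side is the case t = 0 of [iter_dunkl], with monomial 1 and no low factors. *)
have shifted := iter_dunkl kappa' g m0; rewrite split00 !mul1r in shifted.
apply: (etrans (iter_dunkl kappa g tm)).
apply/esym/(etrans (congr1 ( *%R 'X_[split_mnm i t t]) shifted))/esym.
rewrite k0E subn0.
apply: (congr1 (fun h => 'X_[split_mnm i t t] * subst_pow m h)).
rewrite (@shift_prod_intertwine _ _ _ (step_high kappa`_0) _ _ (step_shift kappa')).
  rewrite (eq_shift_prod _ _ shift_high).
  set D := sym_dunkl _ _ g.
  (* With D innermost on both sides, the factors k <= t and k > t occur in opposite orders;
     linearity of [step_high] lets them commute. *)
  rewrite shift_prodZ shift_prod_comm.
  rewrite -[X in _ = shift_prod _ _ _ X _](_ : (t + (m.-1 - t) = m.-1)%N); last by lia.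
  by rewrite shift_prodD add0n.
by move=> k f kt; rewrite sym_dunkl_step_low shift_low.
Qed.

End DunklPower.

Theorem proposition3p23 (R : realType) (m N : nat) (hm : (2 <= m)%N)
    (hN : (1 <= N)%N) (kappa : m.-tuple R[i]) (t : nat)
    (ht : (1 <= t <= m - 1)%N) (g : {mpoly R[i][N]}) (i : 'I_N) :
  let v : 'X_{1..N} := [multinom 1%N | k < N] in
  let gy : {mpoly R[i][N]} := g \mPo [tuple 'X_k ^+ m | k < N] in
  iter m (dunkl (eta_m R m) kappa i) ('X_[(v *+ t)%MM] * gy)
  = 'X_[(v *+ t)%MM] * iter m (dunkl (eta_m R m) (kappa_shift t kappa) i) gy.
Proof.
(* Writing x^(tv) as [split_mnm i t t] frees the exponent of x_i to vary alone. *)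
move=> v gy; rewrite (_ : (v *+ t)%MM = split_mnm i t t).
  by apply: iter_dunkl_shift ht; apply: eta_m_prim; apply: ltnW.
by apply/mnmP => k; rewrite mulmnE !mnmE mul1n if_same.
Qed.
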